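(* Let $\mathcal{H}$ be a real Hilbert space, and let $f\colon\mathcal{H}\to\mathbb{R}$ be a closed convex function that is continuously hypodifferentiable on $\mathcal{H}$, with a fixed continuous hypodifferential mapping $\underline{d}f(\cdot)$. Let $x_0\in\mathcal{H}$, $\sigma\in(0,1)$, $\gamma\in(0,1)$. Suppose that the set $$S_0=\{x\in\mathcal{H}\mid f(x)\le f(x_0)\}$$ is bounded, and that $\underline{d}f(\cdot)$ is amenable and bounded on $S_0$. Suppose also that $\underline{d}f(\cdot)$ is a Lipschitzian approximation of $f$ on the set $S_\varepsilon=\{x\in\mathcal{H}\mid \operatorname{dist}(x,S_0)\le\varepsilon\}$ for some $\varepsilon>0$, and that a sequence $\{x_n\}$ is generated by the method of hypodifferential descent (MHD) with starting point $x_0$ and parameters $\sigma,\gamma$, with step sizes $\alpha_n$. Then there exists $\widehat{\alpha}>0$ such that $\alpha_n\ge\widehat{\alpha}$ for all $n\in\mathbb{N}$, and the following inequality holds true: $$f(x_n)-f(x^* )\le\frac{(f(x_0)-f(x^* ))R^2}{R^2+(f(x_0)-f(x^* ))\,\widehat{\alpha}\,\sigma\, n}=\mathcal{O}\left(\frac1n\right)\quad\forall n\in\mathbb{N}.$$ Here $x^*$ is a point of global minimum of $f$, and $R=1+\sup_{n\ge0}\|x_n-x^*\|<+\infty$.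
   Context: The space $\mathbb{R}\times\mathcal{H}$ carries the norm $\|(a,v)\|^2=a^2+\|v\|^2$. **Hypodifferentiability.** $f\colon\mathcal{H}\to\mathbb{R}$ is hypodifferentiable at $x$ if there is a weakly compact convex set $\underline{d}f(x)\subset\mathbb{R}\times\mathcal{H}$ (a hypodifferential of $f$ at $x$) such that $\max_{(a,v)\in\underline{d}f(x)}a=0$ and for every $\Delta x\in\mathcal{H}$ $$\lim_{\alpha\to+0}\frac1\alpha\Big|f(x+\alpha\Delta x)-f(x)-\max_{(a,v)\in\underline{d}f(x)}\big(a+\alpha\langle v,\Delta x\rangle\big)\Big|=0.$$ A hypodifferential mapping assigns to each $x\in\mathcal{H}$ such a set $\underline{d}f(x)$. $f$ is continuously hypodifferentiable on $\mathcal{H}$ if it has a hypodifferential mapping that is Hausdorff continuous on $\mathcal{H}$; such a mapping is called continuous. **Amenability.** For a nonempty convex $C\subseteq\mathcal{H}$, $\underline{d}f(\cdot)$ is amenable on $C$ if for every $x\in C$ and $(a,v)\in\underline{d}f(x)$ one has $f(y)-f(x)\ge a+\langle v,y-x\rangle$ for all $y\in C$. **Lipschitzian approximation.** For a nonempty set $C\subseteq\mathcal{H}$, $\underline{d}f(\cdot)$ is a Lipschitzian approximation of $f$ on $C$ with Lipschitz constant $L>0$ if $$\Big|f(y)-f(x)-\max_{(a,v)\in\underline{d}f(x)}\big(a+\langle v,y-x\rangle\big)\Big|\le\frac L2\|y-x\|^2\quad\forall x,y\in C.$$ It is a Lipschitzian approximation of $f$ on $C$ if this holds for some $L>0$. $\underline{d}f(\cdot)$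 is bounded on $S_0$ if $\bigcup_{x\in S_0}\underline{d}f(x)$ is a bounded subset of $\mathbb{R}\times\mathcal{H}$. Closed means lower semicontinuous (closed epigraph). **MHD.** Given $x_0$ and $\sigma,\gamma\in(0,1)$, for $n=0,1,2,\dots$: let $(a_n,v_n)$ be the minimizer of $\|(a,v)\|^2$ over $(a,v)\in\underline{d}f(x_n)$; let $\alpha_n$ be the largest number of the form $\gamma^k$, $k\in\mathbb{N}\cup\{0\}$, such that $f(x_n-\gamma^kv_n)-f(x_n)\le-\gamma^k\sigma\|(a_n,v_n)\|^2$; set $x_{n+1}=x_n-\alpha_nv_n$. *)

(* Defs.v *)
From HB Require Import structures.
From mathcomp Require Import all_boot all_order all_algebra sesquilinear.
From mathcomp Require Import all_classical all_reals all_analysis.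

Set Implicit Arguments.
Unset Strict Implicit.
Unset Printing Implicit Defensive.

Import Order.TTheory GRing.Theory Num.Theory.
Import numFieldNormedType.Exports.

Local Open Scope classical_set_scope.
Local Open Scope ring_scope.

Definition dual (R : realType) (V : normedModType R) : Type :=
  {phi : {linear V -> R^o} | continuous phi}.

Definition dual_eval (R : realType) (V : normedModType R) (x : V) :
    {ptws dual V -> R^o} := fun phi => sval phi x.

Definition weakly_compact (R : realType) (V : normedModType R) (A : set V) :=
  compact (A : set (initial_topology (@dual_eval R V))).

Definition is_max (R : realType) (A : set R) (m : R) := A m /\ ubound A m.

(* The library norm on a product is the maximum norm; this is the Hilbert norm
   of R x H. Both define the same topology, hence the same dual. *)
Definition pnorm (R : realType) (H : normedModType R) (p : R^o * H) : R :=
  Num.sqrt (p.1 ^+ 2 + `|p.2| ^+ 2).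

Definition hausdorff_dist (R : realType) (H : normedModType R)
    (A B : set (R^o * H)) : \bar R :=
  let excess (X Y : set (R^o * H)) :=
    ereal_sup [set ereal_inf [set (pnorm (p - q))%:E | q in Y] | p in X] in
  maxe (excess A B) (excess B A).

Definition hausdorff_continuous (R : realType) (H : normedModType R)
    (D : H -> set (R^o * H)) :=
  forall x, hausdorff_dist (D y) (D x) @[y --> x] --> 0%E.

(* The maximum of a + t <v, y> over (a, v) in A. It is only used for nonempty
   weakly compact A, for which the supremum is attained. *)
Definition hypo_max (R : realType) (H : normedModType R)
    (dot : {dot H for idfun}) (A : set (R^o * H)) (t : R) (y : H) : R :=
  sup [set p.1 + t * dot p.2 y | p in A].

Definition is_hypodifferential (R : realType) (H : normedModType R)
    (dot : {dot H for idfun}) (f : H -> R) (x : H) (A : set (R^o * H)) :=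
  [/\ weakly_compact A,
      convex_set A,
      is_max [set p.1 | p in A] 0
    & forall dx : H,
        t^-1 * `|f (x + t *: dx) - f x - hypo_max dot A t dx|
          @[t --> 0^'+] --> (0 : R)].

Definition continuous_hypodifferential (R : realType) (H : normedModType R)
    (dot : {dot H for idfun}) (f : H -> R) (D : H -> set (R^o * H)) :=
  (forall x, is_hypodifferential dot f x (D x)) /\ hausdorff_continuous D.

Definition amenable (R : realType) (H : normedModType R)
    (dot : {dot H for idfun}) (f : H -> R) (D : H -> set (R^o * H))
    (C : set H) :=
  forall x p y, C x -> D x p -> C y -> p.1 + dot p.2 (y - x) <= f y - f x.

Definition hypo_bounded (R : realType) (H : normedModType R)
    (D : H -> set (R^o * H)) (C : set H) :=
  exists M : R, forall p, (\bigcup_(x in C) D x) p -> pnorm p <= M.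

Definition lipschitzian_approximation (R : realType) (H : normedModType R)
    (dot : {dot H for idfun}) (f : H -> R) (D : H -> set (R^o * H))
    (C : set H) :=
  exists2 L : R, 0 < L & forall x y, C x -> C y ->
    `|f y - f x - hypo_max dot (D x) 1 (y - x)| <= L / 2 * `|y - x| ^+ 2.

Definition sublevel (R : realType) (H : normedModType R) (f : H -> R)
    (x0 : H) : set H :=
  [set x | f x <= f x0].

Definition enlargement (R : realType) (H : normedModType R) (S : set H)
    (eps : R) : set H :=
  [set x | (edist_inf S x <= eps%:E)%E].

Definition global_min (R : realType) (H : normedModType R) (f : H -> R)
    (xs : H) :=
  forall y, f xs <= f y.

Definition is_MHD (R : realType) (H : normedModType R) (f : H -> R)
    (D : H -> set (R^o * H)) (x0 : H) (sigma gamma : R)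
    (x : nat -> H) (av : nat -> R^o * H) (alpha : nat -> R) :=
  x 0%N = x0 /\
  forall n,
    [/\ D (x n) (av n),
        forall q, D (x n) q -> pnorm (av n) ^+ 2 <= pnorm q ^+ 2,
        is_max [set t | (exists k : nat, t = gamma ^+ k) /\
                  f (x n - t *: (av n).2) - f (x n)
                    <= - (t * sigma * pnorm (av n) ^+ 2)] (alpha n)
      & x n.+1 = x n - alpha n *: (av n).2].

Definition rate_bound (R : realType) (delta radius alphahat sigma : R)
    (n : nat) : R :=
  delta * radius ^+ 2 / (radius ^+ 2 + delta * alphahat * sigma * n%:R).

(* Main.v *)
Require Import Defs.
From HB Require Import structures.
From mathcomp Require Import all_boot all_order all_algebra sesquilinear.
From mathcomp Require Import all_classical all_reals all_analysis.
From mathcomp Require Import ring lra.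

Set Implicit Arguments.
Unset Strict Implicit.
Unset Printing Implicit Defensive.

Import Order.TTheory GRing.Theory Num.Theory.
Import numFieldNormedType.Exports.

Local Open Scope classical_set_scope.
Local Open Scope ring_scope.

(** The proof has three independent ingredients.

    A minimum exists by completeness and the parallelogram identity.
    For a decreasing sequence of nonempty closed convex sets in a bounded
    region, points of almost minimal norm form a Cauchy sequence,
    and their limit lies in every set
    ([nested_convex_nonempty]). Applied to sublevel sets of [f], this shows
    that [f] is bounded below and attains its infimum ([convex_lsc_has_min]).

    The step sizes stay away from zero because the element [(a_n, v_n)] of
    least norm of the convex set [D x_n] satisfies
    [a a_n + <v, v_n> >= a_n ^ 2 + |v_n| ^ 2] for every [(a, v)] in [D x_n]
    ([min_pnorm_variational]). As [a <= 0] on [D x_n], for [t |a_n| <= 1] this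
    bounds the maximum of [a - t <v, v_n>] by [- t |(a_n, v_n)| ^ 2]. The
    Lipschitzian approximation then yields the line search inequality for all
    [t] below a threshold depending only on the Lipschitz constant, [sigma],
    [eps] and the bound on [D] ([sufficient_decrease]); so every [alpha_n] is
    at least a fixed power of [gamma] below this threshold. That the trial
    point must lie in the enlargement of the sublevel set, where the
    approximation is valid, is where [eps] and the bound on [D] enter.

    For the rate, amenability at [(a_n, v_n)] and a minimizer [xs] gives
    [f x_n - f xs <= - a_n + <v_n, x_n - xs> <= |(a_n, v_n)| R], so the line
    search turns into the recursion [d_(n+1) <= d_n - q d_n ^ 2] for the gaps
    [d_n = f x_n - f xs], with [q = alphahat sigma / R ^ 2]. Heuristically
    [1 / d_(n+1) >= 1 / d_n + q], whence [d_n <= d_0 / (1 + d_0 q n)]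
    ([sublinear_rate]). *)

(** * Geometry of the inner product *)

Lemma dot_sym (R : realType) (H : normedModType R) (dot : {dot H for idfun})
  (u v : H) : dot u v = dot v u.
Proof. by rewrite hermC expr0 mul1r. Qed.

Lemma sqr_normD (R : realType) (H : normedModType R) (dot : {dot H for idfun})
    (dot_norm : forall u : H, dot u u = `|u| ^+ 2) (u v : H) :
  `|u + v| ^+ 2 = `|u| ^+ 2 + `|v| ^+ 2 + 2 * dot u v.
Proof. by rewrite -!dot_norm hnormD expr0 mul1r mulr_natl. Qed.

Lemma sqr_normB (R : realType) (H : normedModType R) (dot : {dot H for idfun})
    (dot_norm : forall u : H, dot u u = `|u| ^+ 2) (u v : H) :
  `|u - v| ^+ 2 = `|u| ^+ 2 + `|v| ^+ 2 - 2 * dot u v.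
Proof. by rewrite (sqr_normD dot_norm) normrN linearNr mulrN. Qed.

(** The parallelogram identity, solved for the distance: it makes two points
    close as soon as the norm of their midpoint is not much below theirs. *)
Lemma sqr_dist_midpoint (R : realType) (H : normedModType R)
    (dot : {dot H for idfun})
    (dot_norm : forall u : H, dot u u = `|u| ^+ 2) (u v : H) :
  `|u - v| ^+ 2 =
  2 * `|u| ^+ 2 + 2 * `|v| ^+ 2 - 4 * `|2^-1 *: u + 2^-1 *: v| ^+ 2.
Proof.
rewrite -[2^-1 *: u + _]scalerDr normrZ exprMn.
rewrite (sqr_normB dot_norm) (sqr_normD dot_norm).
by rewrite real_normK ?num_real//; field.
Qed.

(** Expand the square of [| |v| u - |u| v |], which is
    [2 |u| |v| (|u| |v| - <u, v>)], and divide by the norms. *)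
Lemma dot_le_norm (R : realType) (H : normedModType R)
    (dot : {dot H for idfun})
    (dot_norm : forall u : H, dot u u = `|u| ^+ 2) (u v : H) :
  dot u v <= `|u| * `|v|.
Proof.
have [->|u0] := eqVneq u 0; first by rewrite linear0l normr0 mul0r.
have [->|v0] := eqVneq v 0; first by rewrite linear0r normr0 mulr0.
have uv0 : 0 < `|u| * `|v| by rewrite mulr_gt0 ?normr_gt0.
have := sqr_ge0 `| `|v| *: u - `|u| *: v|.
have dotZ : dot (`|v| *: u) (`|u| *: v) = `|v| * (`|u| * dot u v).
  by rewrite (linearZl_LR dot) (linearZr_LR dot).
rewrite (sqr_normB dot_norm) !normrZ !normr_id dotZ.
by move=> h; rewrite -subr_ge0 -(pmulr_rge0 _ uv0); lra.
Qed.

(** * Existence of a minimizer *)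

(** A substitute for weak compactness of bounded closed convex sets. Pick
    [y n] in [C n] whose squared norm exceeds the infimum over [C n] by less
    than [1 / (n + 1)]. These infima increase and are bounded; two late terms
    have their midpoint in an earlier set, so the midpoint has squared norm
    close to the common limit and the terms are close to each other. *)
Lemma nested_convex_nonempty (R : realType) (H : completeNormedModType R)
    (dot : {dot H for idfun})
    (dot_norm : forall u : H, dot u u = `|u| ^+ 2) (C : nat -> set H) (M : R) :
  (forall n, C n !=set0) ->
  (forall n, closed (C n)) ->
  (forall n u v, C n u -> C n v -> C n (2^-1 *: u + 2^-1 *: v)) ->
  (forall m n, (m <= n)%N -> C n `<=` C m) ->
  (forall u, C 0%N u -> `|u| <= M) ->
  exists z, forall n, C n z.
Proof.
move=> C0 Ccl Cmid Cdec CM.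
pose E n : set R := [set `|u| ^+ 2 | u in C n].
pose e n := inf (E n).
have Elb n : has_lbound (E n) by exists 0 => _ [u _ <-]; exact: sqr_ge0.
have E0 n : E n !=set0 by have [u Cu] := C0 n; exists (`|u| ^+ 2); exists u.
have eP n u : C n u -> e n <= `|u| ^+ 2.
  by move=> Cu; apply: (ge_inf (Elb n)); exists u.
have [y yP] : {y : nat -> H &
    forall n, C n (y n) /\ `|y n| ^+ 2 < e n + n.+1%:R^-1}.
  apply: (@choice _ _ (fun n u => C n u /\ `|u| ^+ 2 < e n + n.+1%:R^-1)) => n.
  have [_ [u Cu <-] lt_u] : exists2 r, E n r & r < e n + n.+1%:R^-1.
    by apply: inf_adherent; [rewrite invr_gt0 ltr0n|split].
  by exists u.
have eub : has_ubound (range e).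
  exists (M ^+ 2) => _ [n _ <-]; have [u Cu] := C0 n.
  apply: le_trans (eP _ _ Cu) _; have := CM u (Cdec _ _ (leq0n n) _ Cu) => uM.
  by rewrite lerXn2r ?nnegrE ?(le_trans _ uM).
have les n : e n <= sup (range e) by apply: ub_le_sup => //; exists n.
(* With [s] the supremum of the infima, late terms have squared norm below
   [s + eps ^ 2 / 8] and their midpoint above [s - eps ^ 2 / 8], so the
   parallelogram identity bounds their squared distance by [eps ^ 2]. *)
have ycvg : cvg (y @ \oo).
  apply: cauchy_cvg; apply: cauchy_exP => eps eps0.
  have eps8 : 0 < eps ^+ 2 / 8 by rewrite divr_gt0 ?exprn_gt0.
  have [|_ [N1 _ <-] hN1] := @sup_adherent R (range e) _ eps8.
    by split=> //; exists (e 0%N); exists 0%N.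
  have [N2 _ hN2] : \forall n \near \oo, n.+1%:R^-1 < eps ^+ 2 / 8 :> R.
    by apply: near_infty_natSinv_lt (PosNum eps8).
  pose N := maxn N1 N2; exists (y N); exists N => // n /= Nn.
  have CN1 k : (N <= k)%N -> C N1 (y k).
    move=> Nk; apply: (Cdec _ k); last by have [] := yP k.
    by apply: leq_trans Nk; exact: leq_maxl.
  have bnd k : (N <= k)%N -> `|y k| ^+ 2 < sup (range e) + eps ^+ 2 / 8.
    move=> Nk; have [_ hk] := yP k; apply: (lt_trans hk).
    apply: ler_ltD (les k) _; apply: hN2 => /=; apply: leq_trans Nk.
    exact: leq_maxr.
  have hm := eP _ _ (Cmid _ _ _ (CN1 _ (leqnn N)) (CN1 _ Nn)).
  have := bnd _ (leqnn N); have := bnd _ Nn => b1 b2.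
  rewrite -ball_normE /= -(@ltr_pXn2r _ 2) ?nnegrE// ?(ltW eps0)//.
  by rewrite (sqr_dist_midpoint dot_norm); lra.
exists (lim (y @ \oo)) => n.
apply: (@closed_cvg _ _ _ _ y (C n) (Ccl n) _ _ ycvg).
by exists n => // m /= nm; apply: (Cdec _ m) => //; have [] := yP m.
Qed.

Lemma closed_sublevel (R : realType) (H : normedModType R) (f : H -> R)
    (c : R) :
  lower_semicontinuous (EFin \o f) -> closed [set z | f z <= c].
Proof.
move=> /lower_semicontinuousP fo; rewrite -openC.
have -> : ~` [set z | f z <= c] = [set z | (c%:E < (EFin \o f) z)%E].
  by apply/seteqP; split => z /=; rewrite lte_fin ltNge => /negP.
exact: fo.
Qed.

Lemma convex_midpoint (R : realType) (H : normedModType R) (f : H -> R)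
    (u v : H) :
  convex_function [set: convex_lmodType H] f ->
  f (2^-1 *: u + 2^-1 *: v) <= 2^-1 * f u + 2^-1 * f v.
Proof.
move=> fc; have h0 : 0 <= 2^-1 :> R by lra.
have h1 : 2^-1 <= 1 :> R by lra.
have := fc (Itv01 h0 h1) u v.
rewrite !inE => /(_ I I); rewrite convRE /conv /=.
by rewrite /unstable.onem (_ : 1 - 2^-1 = 2^-1 :> R) //; last by field.
Qed.

(** Values can be pushed below any sequence of levels [c n] that [f] meets one
    at a time, by intersecting sublevel sets. Levels tending to minus infinity
    are then impossible, so [f] is bounded below, and levels tending to the
    infimum produce a minimizer. *)
Lemma convex_lsc_has_min (R : realType) (H : completeNormedModType R)
    (dot : {dot H for idfun})
    (dot_norm : forall u : H, dot u u = `|u| ^+ 2) (f : H -> R) (x0 : H) :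
  lower_semicontinuous (EFin \o f) ->
  convex_function [set: convex_lmodType H] f ->
  bounded_set (sublevel f x0) ->
  exists xs, global_min f xs.
Proof.
move=> flsc fconv /ex_strict_bound_gt0[M _ Mbnd].
have levels (c : nat -> R) : (forall m n, (m <= n)%N -> c n <= c m) ->
    c 0%N <= f x0 -> (forall n, exists z, f z <= c n) ->
    exists z, forall n, f z <= c n.
  move=> cdec c0 cne.
  apply: (nested_convex_nonempty dot_norm (C := fun n => [set z | f z <= c n])
    (M := M)) => [|n|n u v /= fu fv|m n mn z /= fz|z /= fz].
  - exact: cne.
  - exact: closed_sublevel.
  - by apply: le_trans (convex_midpoint _ _ fconv) _; lra.
  - exact: le_trans fz (cdec _ _ mn).
  - by apply/ltW/Mbnd; exact: le_trans fz c0.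
have [flb|fnlb] := pselect (has_lbound (range f)); last first.
  have [||n|z fz] := levels (fun n => f x0 - n%:R).
  - by move=> m n mn; rewrite lerD2l lerN2 ler_nat.
  - by rewrite subr0.
  - apply: contrapT => nz; apply: fnlb; exists (f x0 - n%:R) => _ [z _ <-].
    by rewrite leNgt; apply/negP => lt_z; apply: nz; exists z; exact: ltW.
  - exists z => y; exfalso.
    have := fz (Num.bound `|f x0 - f z|).
    have := archi_boundP (normr_ge0 (f x0 - f z)).
    have := ler_norm (f x0 - f z).
    lra.
have infP z : inf (range f) <= f z by apply: (ge_inf flb); exists z.
(* Capping the levels at [f x0] keeps them inside the bounded sublevel set. *)
pose c n := Num.min (f x0) (inf (range f) + n.+1%:R^-1).
have [||n|z fz] := levels c.
- move=> m n mn; rewrite le_min ge_min lexx/= ge_min; apply/orP; right.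
  by rewrite lerD2l lef_pV2 ?posrE ?ltr0n// ler_nat.
- by rewrite ge_min lexx.
- have hinf : has_inf (range f) by split=> //; exists (f x0); exists x0.
  have [|_ [z _ <-] zlt] := @inf_adherent R (range f) n.+1%:R^-1 _ hinf.
    by rewrite invr_gt0.
  have [zx0|x0z] := leP (f z) (f x0).
    by exists z; rewrite le_min zx0 ltW.
  by exists x0; rewrite le_min lexx/= (le_trans (ltW x0z))// ltW.
- exists z => y; apply: le_trans (infP y).
  apply/ler_addgt0Pr => eps eps0.
  have [N _ hN] := near_infty_natSinv_lt (PosNum eps0).
  apply: le_trans (fz N) _; rewrite ge_min; apply/orP; right.
  by rewrite lerD2l ltW//; apply: hN => /=.
Qed.

(** * The element of least norm and the line search *)

Lemma sqr_pnorm (R : realType) (H : normedModType R) (p : R^o * H) :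
  pnorm p ^+ 2 = p.1 ^+ 2 + `|p.2| ^+ 2.
Proof. by rewrite sqr_sqrtr// addr_ge0 ?sqr_ge0. Qed.

Lemma norm_fst_le_pnorm (R : realType) (H : normedModType R) (p : R^o * H) :
  `|p.1| <= pnorm p.
Proof. by rewrite -sqrtr_sqr ler_wsqrtr// lerDl sqr_ge0. Qed.

Lemma norm_snd_le_pnorm (R : realType) (H : normedModType R) (p : R^o * H) :
  `|p.2| <= pnorm p.
Proof.
by rewrite -[`|p.2|]ger0_norm// -sqrtr_sqr ler_wsqrtr// lerDr sqr_ge0.
Qed.

(** If [b] were negative, the linear term would dominate for small [t]. *)
Lemma first_variation_ge0 (R : realType) (b c : R) : 0 <= c ->
  (forall t, 0 < t <= 1 -> 0 <= 2 * b * t + c * t ^+ 2) -> 0 <= b.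
Proof.
move=> c0 h; rewrite leNgt; apply/negP => b0.
have cb : 0 < c - b by lra.
(* The vertex [- b / c] of the parabola, with a denominator that is positive
   even for [c = 0] and keeps the value at most 1. *)
have t01 : 0 < - b / (c - b) <= 1.
  by rewrite divr_gt0 ?oppr_gt0//= ler_pdivrMr// mul1r; lra.
have := h _ t01; have [t0 t1] := andP t01.
have -> : 2 * b * (- b / (c - b)) + c * (- b / (c - b)) ^+ 2 =
    (- b / (c - b)) * (b * ((c - 2 * b) / (c - b))).
  by field; rewrite gt_eqF.
rewrite pmulr_rge0// nmulr_rge0// leNgt => /negP; apply.
by rewrite divr_gt0//; lra.
Qed.

(** The variational inequality of the projection of the origin onto a convex
    set: moving from [q] towards [p] cannot decrease the norm to first order. *)
Lemma min_pnorm_variational (R : realType) (H : normedModType R)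
    (dot : {dot H for idfun})
    (dot_norm : forall u : H, dot u u = `|u| ^+ 2)
    (A : set (R^o * H)) (q p : R^o * H) :
  convex_set A -> A q -> (forall r, A r -> pnorm q ^+ 2 <= pnorm r ^+ 2) ->
  A p -> pnorm q ^+ 2 <= p.1 * q.1 + dot p.2 q.2.
Proof.
move=> Acv Aq qmin Ap.
rewrite -subr_ge0.
apply: (@first_variation_ge0 _ _ ((p.1 - q.1) ^+ 2 + `|p.2 - q.2| ^+ 2)).
  by rewrite addr_ge0 ?sqr_ge0.
move=> t /andP[/ltW t0 t1].
have /qmin : A (t *: p + (1 - t) *: q).
  by have := Acv p q (Itv01 t0 t1); rewrite !inE => /(_ Ap Aq).
rewrite -subr_ge0 !sqr_pnorm /= => qle; apply: le_trans qle _.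
have -> : t *: p.2 + (1 - t) *: q.2 = q.2 + t *: (p.2 - q.2).
  by rewrite scalerBl scale1r scalerBr addrCA.
have dotE : dot q.2 (t *: (p.2 - q.2)) = t * (dot p.2 q.2 - `|q.2| ^+ 2).
  by rewrite (linearZr_LR dot) (linearBr dot) -dot_norm (dot_sym dot p.2).
rewrite (sqr_normD dot_norm) normrZ exprMn real_normK ?num_real// dotE.
rewrite /GRing.scale /=; lra.
Qed.

(** The strict inequality is convenient because distances to sets are built
    from open balls. *)
Lemma mem_enlargement (R : realType) (H : normedModType R) (S : set H)
    (eps : R) (u v : H) :
  0 < eps -> S u -> `|v - u| < eps -> enlargement S eps v.
Proof.
move=> eps0 Su vu; rewrite /enlargement /=.
apply: (@ge_ereal_inf R _ eps%:E); exists (edist (v, u)); first by exists u.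
by apply: edist_fin => //; rewrite -ball_normE.
Qed.

(** For [p] in [A] the variational inequality gives
    [p.1 - t <p.2, q.2> <= p.1 (1 + t q.1) - t |q| ^ 2], and the first term is
    at most zero because [p.1 <= 0] and [t |q.1| <= 1]. So the model decreases
    by [t |q| ^ 2], and the quadratic error [L / 2 t ^ 2 |q| ^ 2] eats up at
    most the fraction [1 - sigma] of it. *)
Lemma sufficient_decrease (R : realType) (H : normedModType R)
    (dot : {dot H for idfun})
    (dot_norm : forall u : H, dot u u = `|u| ^+ 2) (f : H -> R) (y : H)
    (A : set (R^o * H)) (q : R^o * H) (L t sigma : R) :
  convex_set A -> (forall p, A p -> p.1 <= 0) ->
  A q -> (forall r, A r -> pnorm q ^+ 2 <= pnorm r ^+ 2) ->
  0 < L -> 0 <= t -> t * `|q.1| <= 1 -> L * t <= 2 * (1 - sigma) ->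
  `|f (y - t *: q.2) - f y - hypo_max dot A 1 (- (t *: q.2))|
    <= L / 2 * `|t *: q.2| ^+ 2 ->
  f (y - t *: q.2) - f y <= - (t * sigma * pnorm q ^+ 2).
Proof.
move=> Acv A0 Aq qmin L0 t0 tq tL /ler_normlP[_ flip].
have maxle : hypo_max dot A 1 (- (t *: q.2)) <= - (t * pnorm q ^+ 2).
  apply: ge_sup; first by exists (q.1 + 1 * dot q.2 (- (t *: q.2))); exists q.
  move=> _ [p Ap <-]; rewrite mul1r linearNr (linearZr_LR dot) /=.
  have := min_pnorm_variational dot_norm Acv Aq qmin Ap.
  have := A0 _ Ap; have := A0 _ Aq.
  move: tq; rewrite (ler0_norm (A0 _ Aq)).
  move: (dot p.2 q.2) => d; nra.
move: flip; rewrite normrZ exprMn real_normK ?num_real// => flip.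
have : `|q.2| ^+ 2 <= pnorm q ^+ 2 by rewrite sqr_pnorm lerDr sqr_ge0.
set N := pnorm q ^+ 2 in maxle *; set V := `|q.2| ^+ 2 in flip *.
move=> VN; have : 0 <= t * (2 * (1 - sigma) - L * t) * N.
  by rewrite mulr_ge0 ?sqr_ge0// mulr_ge0// subr_ge0.
have : 0 <= L * t ^+ 2 * (N - V).
  by rewrite mulr_ge0 ?subr_ge0// mulr_ge0 ?sqr_ge0// ltW.
lra.
Qed.

(** * Convergence rate *)

(** By induction, a division-free form of [1 / d (n + 1) >= 1 / d n + q], so
    that it also covers gaps that vanish. The inductive step rests on
    [(1 - q d_n) (1 + q d_n) <= 1]; it multiplies the induction hypothesis by
    [1 - q d_n], and when this factor is not positive the gap [d (n + 1)] is
    zero. *)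
Lemma sublinear_rate (R : realType) (d : nat -> R) (q : R) :
  0 <= q -> (forall n, 0 <= d n) ->
  (forall n, d n.+1 <= d n - q * d n ^+ 2) ->
  forall n, d n * (1 + d 0%N * q * n%:R) <= d 0%N.
Proof.
move=> q0 d0 dS; elim => [|n IH]; first by rewrite mulr0 addr0 mulr1.
have B0 : 0 <= 1 + d 0%N * q * n%:R by rewrite addr_ge0 ?mulr_ge0.
have dq0 : 0 <= d 0%N * q by rewrite mulr_ge0.
have -> : d 0%N * q * n.+1%:R = d 0%N * q * n%:R + d 0%N * q.
  by rewrite -natr1 mulrDr mulr1.
rewrite addrA.
have [le1|gt1] := leP (1 - q * d n) 0.
  have -> : d n.+1 = 0.
    apply: le_anti; rewrite d0 andbT (le_trans (dS n))//.
    by have := d0 n; nra.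
  by rewrite mul0r.
apply: (@le_trans _ _ ((1 - q * d n) * (d n * (1 + d 0%N * q * n%:R)
                         + d 0%N * (q * d n)))).
  apply: (@le_trans _ _ ((d n - q * d n ^+ 2)
                            * (1 + d 0%N * q * n%:R + d 0%N * q))).
    by rewrite ler_wpM2r// addr_ge0.
  by rewrite le_eqVlt; apply/orP; left; apply/eqP; ring.
apply: (@le_trans _ _ ((1 - q * d n) * (d 0%N + d 0%N * (q * d n)))).
  by rewrite ler_wpM2l ?lerD2r// ltW.
have := mulr_ge0 (d0 0%N) (sqr_ge0 (q * d n)); lra.
Qed.

Lemma rate_bound_bigO (R : realType) (delta radius alphahat sigma : R) :
  0 <= delta -> 0 < radius -> 0 < alphahat -> 0 < sigma ->
  (rate_bound delta radius alphahat sigma : nat -> R^o) =O_\oo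
    (fun n => (n%:R : R^o)^-1).
Proof.
move=> delta0 radius0 alpha0 sigma0; apply/eqO_exP.
have as0 : 0 < alphahat * sigma by rewrite mulr_gt0.
have r20 : 0 < radius ^+ 2 by rewrite exprn_gt0.
(* The constant obtained by dropping [radius ^+ 2] from the denominator. *)
exists (radius ^+ 2 / (alphahat * sigma)); first by rewrite divr_gt0.
exists 1%N => // n /= n0; have n0R : 0 < n%:R :> R by rewrite ltr0n.
have das : 0 <= delta * alphahat * sigma by rewrite -mulrA mulr_ge0// ltW.
have den0 : 0 < radius ^+ 2 + delta * alphahat * sigma * n%:R.
  by rewrite ltr_wpDr// mulr_ge0// ltW.
rewrite /rate_bound ger0_norm; last first.
  by apply: divr_ge0; [apply: mulr_ge0|]; rewrite // ltW.
rewrite ger0_norm ?invr_ge0//.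
rewrite ler_pdivrMr//.
have -> : radius ^+ 2 / (alphahat * sigma) / n%:R
    * (radius ^+ 2 + delta * alphahat * sigma * n%:R)
    = delta * radius ^+ 2
      + radius ^+ 2 * (radius ^+ 2 / (alphahat * sigma * n%:R)).
  by field; rewrite !gt_eqF.
rewrite lerDl; apply: mulr_ge0; rewrite ?(ltW r20)//.
by apply: divr_ge0; [exact: ltW|apply: mulr_ge0; rewrite // ltW].
Qed.

Theorem theorem3p5 (R : realType) (H : completeNormedModType R)
  (dot : {dot H for idfun})
  (dot_norm : forall u : H, dot u u = `|u| ^+ 2)
  (f : H -> R) (D : H -> set (R^o * H))
  (f_closed : lower_semicontinuous (EFin \o f))
  (f_convex : convex_function [set: convex_lmodType H] f)
  (D_hypo : continuous_hypodifferential dot f D)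
  (x0 : H) (sigma gamma : R)
  (sigma01 : 0 < sigma < 1) (gamma01 : 0 < gamma < 1)
  (S0_bounded : bounded_set (sublevel f x0))
  (D_amenable : amenable dot f D (sublevel f x0))
  (D_bounded : hypo_bounded D (sublevel f x0))
  (D_lip : exists2 eps : R, 0 < eps &
     lipschitzian_approximation dot f D (enlargement (sublevel f x0) eps))
  (x : nat -> H) (av : nat -> R^o * H) (alpha : nat -> R)
  (x_MHD : is_MHD f D x0 sigma gamma x av alpha) :
  exists alphahat : R,
    [/\ 0 < alphahat,
        forall n, alphahat <= alpha n,
        exists xs, global_min f xs
      & forall xs, global_min f xs ->
          let dists := range (fun n => `|x n - xs|) in
          let radius := 1 + sup dists in
          let bound := rate_bound (f x0 - f xs) radius alphahat sigma in
          [/\ has_ubound dists,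
              forall n, f (x n) - f xs <= bound n
            & (bound : nat -> R^o) =O_\oo (fun n => (n%:R : R^o)^-1)]].
Proof.
have [sigma0 sigma1] := andP sigma01; have [gamma0 gamma1] := andP gamma01.
have [x_0 x_step] := x_MHD.
have [D_at _] := D_hypo.
have D_cvx y : convex_set (D y) by have [] := D_at y.
have D_le0 y p : D y p -> p.1 <= 0.
  by move=> Dp; have [_ _ [_ +] _] := D_at y; apply; exists p.
have [M DM] := D_bounded.
have [eps eps0 [L L0 lip]] := D_lip.
have gamma_ge0 k : 0 <= gamma ^+ k by rewrite exprn_ge0// ltW.
have fS n : f (x n.+1) - f (x n) <= - (alpha n * sigma * pnorm (av n) ^+ 2).
  by have [_ _ [[_ +] _] ->] := x_step n.
have alpha_ge0 n : 0 <= alpha n.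
  by have [_ _ [[[k ->] _] _] _] := x_step n.
have xS0 n : sublevel f x0 (x n).
  elim: n => [|n IH]; first by rewrite /sublevel /= x_0.
  rewrite /sublevel /=; apply: le_trans IH; rewrite -subr_le0.
  apply: le_trans (fS n) _; rewrite oppr_le0.
  by rewrite mulr_ge0 ?sqr_ge0// mulr_ge0// ltW.
have avM n : pnorm (av n) <= M.
  by apply: DM; exists (x n) => //; have [] := x_step n.
have M0 : 0 <= M by apply: le_trans (avM 0%N); exact: sqrtr_ge0.
(* Every step up to [tmax] passes the line search: the first bound keeps
   [t |a_n| <= 1] and the trial point within [eps] of the sublevel set, with
   [1 + M] instead of [M] to avoid a zero denominator and make the bounds
   strict; the second controls the quadratic error. *)
pose tmax := Num.min (Num.min 1 eps / (1 + M)) (2 * (1 - sigma) / L).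
have M10 : 0 < 1 + M by rewrite ltr_pwDl.
have tmax0 : 0 < tmax.
  by rewrite !lt_min !divr_gt0 ?lt_min ?ltr01 ?mulr_gt0 ?subr_gt0.
have [k gk] : exists k, gamma ^+ k <= tmax.
  have /cvgr0_norm_le/(_ _ tmax0)[k _ hk] : gamma ^+ n @[n --> \oo] --> 0.
    by apply: cvg_expr; rewrite gtr0_norm.
  by exists k; apply: le_trans (hk k (leqnn k)); exact: ler_norm.
have gkM : gamma ^+ k * (1 + M) <= Num.min 1 eps.
  by rewrite -ler_pdivlMr//; apply: le_trans gk _; rewrite ge_min lexx.
have gkL : L * gamma ^+ k <= 2 * (1 - sigma).
  rewrite mulrC -ler_pdivlMr//; apply: le_trans gk _.
  by rewrite ge_min lexx orbT.
have gk0 : 0 < gamma ^+ k by rewrite exprn_gt0.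
have gkav n (r : R) : r <= pnorm (av n) -> gamma ^+ k * r < Num.min 1 eps.
  move=> rav; apply: lt_le_trans gkM; rewrite ltr_pM2l//.
  by rewrite (le_lt_trans rav)// (le_lt_trans (avM n))// ltrDr.
have alpha_lb n : gamma ^+ k <= alpha n.
  have [Dav avmin [_ +] _] := x_step n; apply; split; first by exists k.
  apply: (sufficient_decrease dot_norm (D_cvx (x n)) (@D_le0 (x n)) Dav avmin
    L0) => //.
  - have := gkav n _ (norm_fst_le_pnorm (av n)).
    by rewrite lt_min => /andP[/ltW].
  - have := lip (x n) (x n - gamma ^+ k *: (av n).2).
    rewrite [x n - _ - x n]addrAC subrr add0r normrN; apply.
    + by apply: (mem_enlargement eps0 (xS0 n)); rewrite subrr normr0.
    + apply: (mem_enlargement eps0 (xS0 n)).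
      rewrite addrAC subrr add0r normrN normrZ gtr0_norm//.
      have := gkav n _ (norm_snd_le_pnorm (av n)).
      by rewrite lt_min => /andP[].
exists (gamma ^+ k); split => //.
  exact: (convex_lsc_has_min dot_norm f_closed f_convex S0_bounded).
move=> xs xsmin dists radius bound.
have [B _ SB] := ex_strict_bound_gt0 S0_bounded.
have distub : has_ubound dists.
  exists (B + `|xs|) => _ [n _ <-]; apply: le_trans (ler_normB _ _) _.
  by rewrite lerD2r; apply/ltW/SB/xS0.
have dist_le n : `|x n - xs| <= sup dists by apply: ub_le_sup => //; exists n.
have radius0 : 0 < radius.
  by rewrite /radius ltr_pwDl// (le_trans (normr_ge0 _) (dist_le 0%N)).
have gap0 n : 0 <= f (x n) - f xs by rewrite subr_ge0.
have gap_le n : f (x n) - f xs <= pnorm (av n) * radius.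
  have [Dav _ _ _] := x_step n.
  have := D_amenable (x n) (av n) xs (xS0 n) Dav (xsmin x0).
  rewrite -(opprB (x n) xs) (linearNr dot).
  have := dot_le_norm dot_norm (av n).2 (x n - xs).
  have := norm_fst_le_pnorm (av n); have := norm_snd_le_pnorm (av n).
  rewrite ler_norml => av2 /andP[av1 _] cs am.
  have : `|(av n).2| * `|x n - xs| <= pnorm (av n) * sup dists.
    by apply: ler_pM.
  by rewrite /radius mulrDr mulr1; lra.
pose q := gamma ^+ k * sigma / radius ^+ 2.
have r20 : 0 < radius ^+ 2 by rewrite exprn_gt0.
have q0 : 0 <= q by rewrite divr_ge0 ?mulr_ge0 ?ltW.
have gapS n :
    f (x n.+1) - f xs <= (f (x n) - f xs) - q * (f (x n) - f xs) ^+ 2.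
  have : q * (f (x n) - f xs) ^+ 2 <= alpha n * sigma * pnorm (av n) ^+ 2.
    rewrite /q mulrAC ler_pdivrMr// -[leRHS]mulrA.
    apply: ler_pM; rewrite ?sqr_ge0//.
    + by rewrite ltW// mulr_gt0.
    + by rewrite ler_wpM2r// ltW.
    + by rewrite -exprMn ler_pXn2r ?nnegrE// mulr_ge0 ?sqrtr_ge0// ltW.
  by have := fS n; lra.
split => //.
- move=> n; rewrite /bound /rate_bound.
  have := sublinear_rate q0 gap0 gapS n; rewrite x_0 => rate.
  have fx0 : 0 <= f x0 - f xs by have := gap0 0%N; rewrite x_0.
  have den0 : 0 < radius ^+ 2 + (f x0 - f xs) * gamma ^+ k * sigma * n%:R.
    by rewrite ltr_wpDr// !mulr_ge0// ltW.
  rewrite ler_pdivlMr//.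
  suff -> : radius ^+ 2 + (f x0 - f xs) * gamma ^+ k * sigma * n%:R =
      radius ^+ 2 * (1 + (f x0 - f xs) * q * n%:R).
    by rewrite mulrCA mulrC ler_wpM2r// ltW.
  by rewrite /q; field; rewrite gt_eqF.
- by apply: rate_bound_bigO => //; have := gap0 0%N; rewrite x_0.
Qed.
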